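(* Let $\mathbb K$ be an algebraically closed field of characteristic $0$ and let $$\mathcal B=\mathrm{diag}(\underbrace{b_1,\ldots,b_1}_{\alpha_1},\ldots,\underbrace{b_m,\ldots,b_m}_{\alpha_m},a_1,\ldots,a_k)\in M_n(\mathbb K),$$ where $k,m\ge 0$ are integers, $a_1,\ldots,a_k,b_1,\ldots,b_m\in\mathbb K$ are pairwise distinct and $\alpha_1,\ldots,\alpha_m\ge 2$ are integers. Then: 1) if $m\le 1$, then $\mathcal B$ has an integrator; 2) if $m>k+1$, then $\mathcal B$ does not have an integrator; 3) in all other cases the existence of an integrator depends on the values of the eigenvalues of $\mathcal B$: for any $k,m$ satisfying neither $m\le 1$ nor $m>k+1$ and any multiplicities $\alpha_1,\ldots,\alpha_m\ge 2$, there are pairwise distinct eigenvalues $a_1,\ldots,a_k,b_1,\ldots,b_m\in\mathbb K$ for which $\mathcal B$ has an integrator, and there are pairwise distinct eigenvalues $a_1,\ldots,a_k,b_1,\ldots,b_m\in\mathbb K$ for which $\mathcal B$ has no integrator.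
   Context: For a square matrix $M$, $p_M(x)=\det(xI-M)$. For $B\in M_n(\mathbb K)$ put $\tau(B)=\frac{1}{n}\mathrm{tr}(B)$. A matrix $A\in M_{n+1}(\mathbb K)$ is an integral of $B\in M_n(\mathbb K)$ if $A=\begin{pmatrix} B & u^{\top}\\ v & \tau(B)\end{pmatrix}$ for some row vectors $u,v\in\mathbb K^n$ and $p_B(x)=\frac{1}{n+1}p_A'(x)$; in this case the pair $(u,v)$ is called an integrator of $B$. Thus $B$ has an integrator if and only if it has an integral. *)

(* Defs.v *)
From HB Require Import structures.
From mathcomp Require Import all_boot all_order all_algebra.

Set Implicit Arguments.
Unset Strict Implicit.
Unset Printing Implicit Defensive.

Import GRing.Theory.
Local Open Scope ring_scope.

(* For n = 0 this is 0, since 0^-1 = 0. *)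
Definition tau (K : fieldType) (n : nat) (B : 'M[K]_n) : K :=
  n%:R^-1 * \tr B.

Definition bordered (K : fieldType) (n : nat) (B : 'M[K]_n) (u v : 'rV[K]_n) :
    'M[K]_(n + 1) :=
  block_mx B u^T v (tau B)%:M.

Definition is_integral (K : fieldType) (n : nat) (B : 'M[K]_n)
    (A : 'M[K]_(n + 1)) : Prop :=
  (exists u v : 'rV[K]_n, A = bordered B u v) /\
  char_poly B = (n + 1)%:R^-1 *: (char_poly A)^`().

Definition is_integrator (K : fieldType) (n : nat) (B : 'M[K]_n)
    (u v : 'rV[K]_n) : Prop :=
  is_integral B (bordered B u v).

Definition has_integrator (K : fieldType) (n : nat) (B : 'M[K]_n) : Prop :=
  exists u v : 'rV[K]_n, is_integrator B u v.

Definition diagB (K : fieldType) (m k : nat) (alpha : 'I_m -> nat)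
    (b : 'I_m -> K) (a : 'I_k -> K) : 'M[K]_(\sum_(i < m) alpha i + k) :=
  diag_mx (row_mx (\mxrow_(i < m) (const_mx (b i) : 'rV[K]_(alpha i)))
                  (\row_(j < k) a j)).

Definition pairwise_distinct (K : fieldType) (m k : nat)
    (b : 'I_m -> K) (a : 'I_k -> K) : Prop :=
  [/\ injective b, injective a & forall i j, b i != a j].

(* Main.v *)
(* For [B = diag(d)] the polynomial [p_A] of a bordered matrix equals
   [(x - tau) p_B - \sum_i u_i v_i \prod_(j != i) (x - d_j)], and by partial
   fractions the last sum is an arbitrary multiple, of degree less than [n], of
   [\prod_i (x - b_i)^(alpha_i - 1)].  Hence [B] has an integrator iff [p_B] has
   an antiderivative [Q] vanishing at every [b_i].

   For [m <= 1] a constant can be adjusted.  In general each [b_i] is a root of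
   [Q] of multiplicity at least [alpha_i + 1], so that [m <= k + 1] by degree.
   When [2 <= m <= k + 1], an integrator is obtained from
   [Q = \prod_i (x - b_i)^(alpha_i + 1) \prod_l (x - c_l)], where the [c_l] are
   [k + 1 - m] further points, once all the points are chosen so that the
   numerator of [Q'/Q] has simple roots.  For the negative part, the degree bound
   applied with [k = 0] gives [i, j] with [\int_{b_j}^{b_i} P != 0] for
   [P = \prod_i (x - b_i)^alpha_i]; as
   [\int P (x - a) = \int P x - a \int P], multiplying [P] by a factor [x - a]
   with generic [a] keeps this integral nonzero. *)

Require Import Defs.
From HB Require Import structures.
From mathcomp Require Import all_boot all_order all_algebra all_field ring.

Set Implicit Arguments.
Unset Strict Implicit.
Unset Printing Implicit Defensive.

Import GRing.Theory.
Local Open Scope ring_scope.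

(** * Partial fractions with repeated nodes *)

Lemma dvdp_exp_prod_XsubC (K : fieldType) (I : finType) (d : I -> K) (y : K) :
  ('X - y%:P) ^+ (\sum_i (d i == y)) %| \prod_i ('X - (d i)%:P).
Proof.
elim/big_rec2: _ => [|i n p _ IH]; first exact: dvd1p.
rewrite exprD dvdp_mul //; case: eqP => [->|_]; first exact: dvdpp.
exact: dvd1p.
Qed.

(** The divisibility leaves only simple poles in the quotient of [G] by the product of all factors.
    By induction, [w0] is chosen so that ['X - (d ord0)%:P] divides [G - w0 *: P], and the quotient
    [H] is expanded over the remaining nodes. *)
Lemma partial_fractions (K : fieldType) (n : nat) (d : 'I_n -> K)
    (G : {poly K}) :
  (size G <= n)%N ->
  (forall y, ('X - y%:P) ^+ (\sum_i (d i == y)).-1 %| G) ->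
  exists w : 'I_n -> K,
    G = \sum_i w i *: \prod_(j | j != i) ('X - (d j)%:P).
Proof.
elim: n d G => [|n IHn] d G szG dvdG.
  by exists (fun=> 0); rewrite big_ord0; apply/eqP; rewrite -size_poly_leq0.
pose d' i := d (lift ord0 i); pose P := \prod_i ('X - (d' i)%:P).
have dvdP y : ('X - y%:P) ^+ (\sum_i (d' i == y)) %| P.
  exact: dvdp_exp_prod_XsubC.
have multE y : (\sum_i (d i == y))%N = ((d ord0 == y) + \sum_i (d' i == y))%N.
  by rewrite big_ord_recl.
have szP : size P = n.+1 by rewrite /P -big_enum size_prod_XsubC size_enum_ord.
(* When [d ord0] is a root of [P] the division gives [w0 = 0], as it should. *)
pose w0 := G.[d ord0] / P.[d ord0].
have /factor_theorem[H defH] : root (G - w0 *: P) (d ord0).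
  rewrite rootE !hornerE /w0; have [P0|P0] := eqVneq P.[d ord0] 0.
    rewrite P0 mulr0 subr0 -rootE root_factor_theorem.
    apply: dvdp_trans (dvdG (d ord0)); rewrite multE eqxx /=.
    suff: (0 < \sum_i (d' i == d ord0))%N.
      by case: (\sum_i _)%N => // k _; rewrite exprS dvdp_mulr.
    move/eqP: P0; rewrite horner_prod => /prodf_eq0[i _].
    by rewrite hornerXsubC subr_eq0 eq_sym (bigD1 i) //= => ->.
  by rewrite divfK // subrr.
have szH : (size H <= n)%N.
  have [->|H0] := eqVneq H 0; first by rewrite size_poly0.
  rewrite -ltnS -(_ : size (H * ('X - (d ord0)%:P)) = (size H).+1); last first.
    by rewrite size_Mmonic ?monicXsubC // size_XsubC addnC.
  rewrite -defH.
  rewrite (leq_trans (size_polyD _ _)) // geq_max szG size_polyN.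
  by rewrite (leq_trans (size_scale_leq _ _)) // szP.
(* If [y] is the removed node, one factor cancels and the multiplicity drops by one; otherwise the
   removed factor is coprime to the powers of ['X - y%:P]. *)
have dvdH y : ('X - y%:P) ^+ (\sum_i (d' i == y)).-1 %| H.
  have [dy|dy] := eqVneq (d ord0) y.
    have := dvdG y; rewrite multE dy eqxx /=; have := dvdP y.
    case: (\sum_i _)%N => [|k] hP hG; first exact: dvd1p.
    have: ('X - y%:P) ^+ k.+1 %| H * ('X - y%:P).
      by rewrite -{2}dy -defH dvdp_sub // -mul_polyC dvdp_mull.
    by rewrite mulrC exprS dvdp_mul2l ?polyXsubC_eq0.
  rewrite -(@Gauss_dvdpl _ _ ('X - (d ord0)%:P)); last first.
    by rewrite coprimep_expl // coprimep_XsubC2 // subr_eq0.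
  rewrite -defH; have := dvdG y; rewrite multE (negbTE dy) add0n => hG.
  rewrite dvdp_sub // -mul_polyC dvdp_mull //.
  by apply: dvdp_trans (dvdP y); rewrite dvdp_exp2l // leq_pred.
have [w defw] := IHn d' H szH dvdH.
exists (fun i => if unlift ord0 i is Some j then w j else w0).
rewrite big_ord_recl unlift_none -(subrK (w0 *: P) G) defH addrC; congr (_ + _).
  congr (_ *: _); rewrite big_mkcond big_ord_recl eqxx /= mul1r.
  exact: eq_bigr.
rewrite defw mulr_suml; apply: eq_bigr => i _; rewrite liftK -scalerAl.
congr (_ *: _); rewrite [RHS]big_mkcond big_ord_recl /= mulrC; congr (_ * _).
rewrite big_mkcond; apply: eq_bigr => j _.
by rewrite (inj_eq (@lift_inj _ _)).
Qed.

(** * Characteristic polynomials of diagonal and bordered matrices *)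

Lemma char_poly_diag (K : comNzRingType) (n : nat) (d : 'rV[K]_n) :
  char_poly (diag_mx d) = \prod_i ('X - (d 0 i)%:P).
Proof.
rewrite /char_poly /char_poly_mx.
have -> : 'X%:M - map_mx polyC (diag_mx d) =
          diag_mx (\row_i ('X - (d 0 i)%:P)).
  by apply/matrixP => i j; rewrite !mxE; case: eqP => _; rewrite ?mulr1n // !mulr0n subrr.
by rewrite det_diag; apply: eq_bigr => i _; rewrite !mxE.
Qed.

(** A Schur complement without denominators: [E] is the adjugate of [D], and right multiplication by
    a block matrix of determinant [P] clears the upper right block. The factor [P] is then
    cancelled. *)
Lemma char_poly_bordered_diag (K : fieldType) (n : nat) (d u v : 'rV[K]_n) :
  char_poly (bordered (diag_mx d) u v) =
    ('X - (tau (diag_mx d))%:P) * \prod_i ('X - (d 0 i)%:P)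
    - \sum_i (u 0 i * v 0 i) *: \prod_(j | j != i) ('X - (d 0 j)%:P).
Proof.
set t := tau _; pose P := \prod_i ('X - (d 0 i)%:P).
pose D := diag_mx (\row_i ('X - (d 0 i)%:P)).
pose E := diag_mx (\row_i (\prod_(j | j != i) ('X - (d 0 j)%:P))).
have DE : D *m E = P%:M.
  rewrite /D /E mulmx_diag; apply/matrixP => i j; rewrite !mxE.
  by congr (_ *+ _); rewrite /P [RHS](bigD1 i).
pose U := map_mx polyC u^T; pose V := map_mx polyC v.
have defM : char_poly_mx (bordered (diag_mx d) u v) =
    block_mx D (- U) (- V) ('X - t%:P)%:M.
  rewrite /char_poly_mx /bordered map_block_mx /= scalar_mx_block.
  rewrite opp_block_mx add_block_mx !add0r map_scalar_mx.
  congr block_mx; last by rewrite -raddfB.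
  by apply/matrixP => i j; rewrite !mxE; case: eqP => _; rewrite ?mulr1n // !mulr0n subrr.
have P0 : P != 0 by rewrite monic_neq0 // monic_prod_XsubC.
have detD : \det D = P.
  by rewrite det_diag; apply: eq_bigr => i _; rewrite !mxE.
apply: (mulIf P0); rewrite /char_poly defM.
have {1}-> : P = \det (block_mx 1%:M (E *m U) 0 P%:M : 'M_(n + 1)).
  by rewrite det_ublock det1 mul1r det_scalar1.
rewrite -det_mulmx mulmx_block !mulmx1 !mulmx0 !addr0 mulmxA DE.
rewrite mulNmx mul_mx_scalar mul_scalar_mx subrr det_lblock detD.
rewrite mulrC; congr (_ * _).
rewrite mulNmx addrC -scalar_mxM det_mx11 /E mul_diag_mx !mxE eqxx mulr1n.
congr (_ - _); apply: eq_bigr => i _; rewrite !mxE.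
by rewrite mulrCA mulrC -polyCM mul_polyC [v 0 i * _]mulrC.
Qed.

(** * Antiderivatives in characteristic 0 *)

Lemma leq_size_deriv (K : fieldType) (p : {poly K}) :
  [pchar K] =i pred0 -> (size p <= (size p^`()).+1)%N.
Proof.
move=> /pcharf0P char0; apply/leq_sizeP => [[|j]] //; rewrite ltnS => szj.
have /eqP : p^`()`_j = 0 by rewrite nth_default.
by rewrite coef_deriv -mulr_natr mulf_eq0 char0 orbF => /eqP.
Qed.

Lemma antiderivative_exists (K : fieldType) (p : {poly K}) :
  [pchar K] =i pred0 -> exists q : {poly K}, q^`() = p.
Proof.
move=> /pcharf0P char0.
exists (\poly_(i < (size p).+1) (p`_i.-1 / i%:R)).
apply/polyP => i; rewrite coef_deriv coef_poly ltnS /=.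
case: ltnP => [_|szi]; last by rewrite mul0rn nth_default.
by rewrite -[LHS]mulr_natr divfK // char0.
Qed.

Lemma antiderivative_sub_const (K : fieldType) (p q : {poly K}) (x y : K) :
  [pchar K] =i pred0 -> p^`() = q^`() -> p.[x] - q.[x] = p.[y] - q.[y].
Proof.
move=> char0 eqpq.
have /size1_polyC pqC : (size (p - q)%R <= 1)%N.
  by rewrite (leq_trans (leq_size_deriv _ char0)) // derivB eqpq subrr size_poly0.
by rewrite -!hornerN -!hornerD pqC !hornerC.
Qed.

(** With p = h (X - y)^(a+1), the derivative is h' (X - y)^(a+1) + (a+1) h (X - y)^a, so X - y
    divides (a+1) h, where a+1 is nonzero in the field. *)
Lemma dvdp_exp_antiderivative (K : fieldType) (p : {poly K}) (y : K) (a : nat) :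
  [pchar K] =i pred0 -> root p y -> ('X - y%:P) ^+ a %| p^`() ->
  ('X - y%:P) ^+ a.+1 %| p.
Proof.
move=> char0 py; have /pcharf0P charE := char0; elim: a => [|a IHa] dvd.
  by rewrite expr1 dvdp_XsubCl.
have /dvdpP[h defp] : ('X - y%:P) ^+ a.+1 %| p.
  by apply: IHa; apply: dvdp_trans dvd; rewrite dvdp_exp2l.
move: dvd; rewrite {2}defp [_ ^+ a.+2]exprS dvdp_mul2r ?expf_neq0 ?polyXsubC_eq0 //.
rewrite {1}defp derivM deriv_exp derivXsubC mul1r /=.
rewrite dvdp_addr; last by rewrite dvdp_mull.
rewrite mulrnAr -mulrnAl exprS dvdp_mul2r ?expf_neq0 ?polyXsubC_eq0 //.
by rewrite -scaler_nat dvdpZr // charE.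
Qed.

(** * Integrators of diagonal matrices as antiderivatives *)

Lemma has_integrator_diag (K : fieldType) (n : nat) (d : 'rV[K]_n) :
  [pchar K] =i pred0 ->
  has_integrator (diag_mx d) <->
  exists Q : {poly K}, Q^`() = \prod_i ('X - (d 0 i)%:P) /\
    forall y, (1 < \sum_i (d 0%R i == y))%N -> root Q y.
Proof.
move=> char0; have /pcharf0P charE := char0.
have n1 : (n + 1)%:R != 0 :> K by rewrite charE addn1.
split=> [[u [v [_]]]|[Q [dQ rootQ]]].
  rewrite char_poly_diag => ->.
  exists ((n + 1)%:R^-1 *: char_poly (bordered (diag_mx d) u v)).
  split=> [|y mult_y]; first by rewrite derivZ.
  (* A repeated entry [y] survives the omission of one factor, so every term of the bordered
     characteristic polynomial vanishes there. *)
  have root_prod (s : pred 'I_n) :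
      (0 < \sum_(i | s i) (d 0%R i == y))%N ->
      root (\prod_(i | s i) ('X - (d 0 i)%:P)) y.
    rewrite lt0n sum_nat_eq0 negb_forall => /existsP[i].
    rewrite negb_imply eqb0 negbK => /andP[si /eqP diy].
    rewrite -dvdp_XsubCl (bigD1 i) //= diy dvdp_mulr //.
  rewrite char_poly_bordered_diag rootE hornerZ hornerD hornerM.
  rewrite (rootP (root_prod xpredT _)) ?(ltnW mult_y) //.
  rewrite mulr0 add0r hornerN horner_sum big1 ?oppr0 ?mulr0 // => i _.
  rewrite hornerZ (rootP (root_prod _ _)) ?mulr0 //.
  move: mult_y; rewrite (bigD1 i) //=; case: eqP => _ //.
  by rewrite add0n => /ltnW.
(* [tau] divides by the dimension, so the empty matrix is checked directly. *)
case: n d n1 dQ rootQ => [|n] d n1 dQ rootQ.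
  exists 0, 0; split; first by exists 0, 0.
  rewrite char_poly_bordered_diag char_poly_diag !big_ord0 subr0 mulr1.
  by rewrite derivXsubC invr1 scale1r.
pose P := \prod_i ('X - (d 0 i)%:P); pose t := tau (diag_mx d).
have Pchar : P = char_poly (diag_mx d) by rewrite char_poly_diag.
pose Q1 := (n.+1 + 1)%:R *: Q; pose G := ('X - t%:P) * P - Q1.
have dQ1 : Q1^`() = (n.+1 + 1)%:R *: P by rewrite derivZ dQ.
(* In the derivative of [G] the coefficients of degree [n.+1] and [n] cancel, the latter because [t]
   is the mean of the entries. *)
have szG : (size G <= n.+1)%N.
  have dG : G^`() = ('X - t%:P) * P^`() - n.+1%:R *: P.
    rewrite derivB derivM derivXsubC mul1r dQ1 natrD scalerDl scale1r.
    by rewrite opprD addrACA addrC addrA addrNK addrC.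
  apply: leq_trans (leq_size_deriv _ char0) _; rewrite ltnS.
  apply/leq_sizeP => j le_nj; rewrite dG mulrBl !coefB coefXM coefZ coefCM.
  have XdP : (if j == 0%N then 0 else P^`()`_j.-1) = j%:R * P`_j.
    by case: (j) => [|i] /=; rewrite ?mul0r // coef_deriv mulr_natl.
  rewrite XdP coef_deriv -[_ *+ j.+1]mulr_natr; move: le_nj; rewrite leq_eqVlt.
  have szP : size P = n.+2 by rewrite Pchar size_char_poly.
  case/orP => [/eqP <-|lt_nj].
    have -> : P`_n = - \tr (diag_mx d) by rewrite Pchar -char_poly_trace.
    have -> : P`_n.+1 = 1.
      by rewrite -(monicP (char_poly_monic (diag_mx d))) -Pchar lead_coefE szP.
    rewrite /t /tau mul1r [_ * n.+1%:R]mulrC mulVKf ?charE // -natr1; ring.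
  rewrite [P`_j.+1]nth_default ?szP // mul0r mulr0 subr0 -mulrBl.
  move: lt_nj; rewrite leq_eqVlt => /orP[/eqP <-|lt_nj].
    by rewrite subrr mul0r.
  by rewrite nth_default ?mulr0 ?szP.
(* At a repeated entry [Q1] vanishes even to the order of the multiplicity plus one; for
   multiplicity at most 1 the exponent is 0. *)
have dvdG y : ('X - y%:P) ^+ (\sum_i (d 0%R i == y)).-1 %| G.
  have dvdP := dvdp_exp_prod_XsubC (fun i => d 0 i) y.
  apply: dvdp_sub.
    by rewrite dvdp_mull // (dvdp_trans _ dvdP) // dvdp_exp2l // leq_pred.
  have [mult_y|mult_y] := leqP (\sum_i (d 0%R i == y)) 1.
    by case: (\sum_i _)%N mult_y => [|[|k]] // _; exact: dvd1p.
  rewrite /Q1 -mul_polyC dvdp_mull //.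
  apply: (@dvdp_trans _ (('X - y%:P) ^+ (\sum_i (d 0%R i == y)).+1)).
    by rewrite dvdp_exp2l // (leq_trans (leq_pred _)) // leqnSn.
  by apply: dvdp_exp_antiderivative; rewrite ?dQ // rootQ.
have [w defG] := partial_fractions szG dvdG.
(* Only the products u_i v_i enter the characteristic polynomial, so [v] may be constant. *)
exists (\row_i w i), (const_mx 1); split.
  by exists (\row_i w i), (const_mx 1).
have -> : char_poly (bordered (diag_mx d) (\row_i w i) (const_mx 1)) = Q1.
  rewrite char_poly_bordered_diag -[RHS](subKr (('X - t%:P) * P)) -/G defG.
  by congr (_ - _); apply: eq_bigr => i _; rewrite !mxE mulr1.
by rewrite dQ1 scalerA mulVf // scale1r.
Qed.

(** * Diagonal matrices with prescribed multiplicities *)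

(** The diagonal of [diagB], named so that products and counts over it can be split by blocks. *)
Definition rowB (K : fieldType) (m k : nat) (alpha : 'I_m -> nat)
    (b : 'I_m -> K) (a : 'I_k -> K) : 'rV[K]_(\sum_(i < m) alpha i + k) :=
  row_mx (\mxrow_(i < m) (const_mx (b i) : 'rV[K]_(alpha i)))
         (\row_(j < k) a j).

Lemma big_rowB (R : Type) (idx : R) (op : Monoid.com_law idx) (K : fieldType)
    (m k : nat) (alpha : 'I_m -> nat) (b : 'I_m -> K) (a : 'I_k -> K)
    (F : K -> R) :
  \big[op/idx]_i F (rowB alpha b a 0 i) =
  op (\big[op/idx]_i \big[op/idx]_(j < alpha i) F (b i))
     (\big[op/idx]_j F (a j)).
Proof.
rewrite big_split_ord; congr (op _ _).
  rewrite sig_big_dep (reindex _ tagnat.sig_bij_on) /=.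
  by apply: eq_bigr => i _; rewrite row_mxEl !mxE.
by apply: eq_bigr => j _; rewrite row_mxEr mxE.
Qed.

(** The characteristic polynomial of [diagB alpha b a], in factored form. *)
Definition polyB (K : fieldType) (m k : nat) (alpha : 'I_m -> nat)
    (b : 'I_m -> K) (a : 'I_k -> K) : {poly K} :=
  \prod_i ('X - (b i)%:P) ^+ alpha i * \prod_j ('X - (a j)%:P).

Lemma size_polyB (K : fieldType) (m k : nat) (alpha : 'I_m -> nat)
    (b : 'I_m -> K) (a : 'I_k -> K) :
  size (polyB alpha b a) = (\sum_(i < m) alpha i + k).+1.
Proof.
transitivity (size (\prod_i ('X - (rowB alpha b a 0 i)%:P))).
  rewrite (big_rowB _ alpha b a (fun x => 'X - x%:P)) /polyB.
  by under [in RHS]eq_bigr do rewrite prodr_const card_ord.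
by rewrite -big_enum size_prod_XsubC size_enum_ord.
Qed.

(** As each [alpha i] is at least 2 and the [a j] are distinct, the repeated diagonal entries are
    exactly the [b i]. *)
Lemma has_integrator_diagB (K : fieldType) (m k : nat) (alpha : 'I_m -> nat)
    (b : 'I_m -> K) (a : 'I_k -> K) :
  [pchar K] =i pred0 -> (forall i, (2 <= alpha i)%N) ->
  pairwise_distinct b a ->
  has_integrator (diagB alpha b a) <->
  exists Q : {poly K}, Q^`() = polyB alpha b a /\ forall i, root Q (b i).
Proof.
move=> char0 alpha_ge2 [inj_b inj_a ba].
have multE y : (\sum_i (rowB alpha b a 0%R i == y) =
    \sum_i alpha i * (b i == y) + \sum_j (a j == y))%N.
  rewrite (big_rowB _ alpha b a (fun x => (x == y) : nat)).
  by under eq_bigr do rewrite big_const_ord iter_addn_0 mulnC.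
have rep y : (1 < \sum_i (rowB alpha b a 0%R i == y))%N <-> exists i, b i = y.
  rewrite multE; split=> [|[i <-]]; last first.
    by rewrite (bigD1 i) //= eqxx muln1 -addnA ltn_addr.
  case: (pickP (fun i => b i == y)) => [i /eqP <-|noy]; first by exists i.
  rewrite big1 => [|i _]; last by rewrite noy muln0.
  case: (pickP (fun j => a j == y)) => [j /eqP <-|noay].
    rewrite (bigD1 j) //= eqxx big1 // => j' /negbTE.
    by rewrite (inj_eq inj_a) => ->.
  by rewrite big1 // => j _; rewrite noay.
have -> : diagB alpha b a = diag_mx (rowB alpha b a) by [].
rewrite has_integrator_diag // (big_rowB _ alpha b a (fun x => 'X - x%:P)).
under eq_bigr do rewrite prodr_const card_ord.
split=> -[Q [dQ rootQ]]; exists Q; split=> //.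
  by move=> i; apply/rootQ/rep; exists i.
by move=> y /rep[i <-].
Qed.

(** * The degree bound *)

(** The pairwise coprime powers of exponent [(alpha i).+1] all divide [Q], whose degree is one more
    than that of [polyB alpha b a]. *)
Lemma root_antiderivative_le (K : fieldType) (m k : nat) (alpha : 'I_m -> nat)
    (b : 'I_m -> K) (a : 'I_k -> K) (Q : {poly K}) :
  [pchar K] =i pred0 -> injective b ->
  Q^`() = polyB alpha b a -> (forall i, root Q (b i)) -> (m <= k.+1)%N.
Proof.
move=> char0 inj_b dQ rootQ.
have Q0 : Q != 0.
  apply: contra_eq_neq dQ => ->; rewrite deriv0 eq_sym -size_poly_gt0.
  by rewrite size_polyB.
have dvdQ i : ('X - (b i)%:P) ^+ (alpha i).+1 %| Q.
  apply: dvdp_exp_antiderivative => //.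
  by rewrite dQ /polyB (bigD1 i) //= -mulrA dvdp_mulr.
have dvd_prod (s : seq 'I_m) : uniq s ->
    \prod_(i <- s) ('X - (b i)%:P) ^+ (alpha i).+1 %| Q.
  elim: s => [|i s IHs] /=; first by rewrite big_nil dvd1p.
  case/andP=> i_s uniq_s; rewrite big_cons Gauss_dvdp ?dvdQ ?IHs //.
  rewrite coprimep_expl // big_seq.
  apply: (big_ind (fun p => coprimep _ p)) => [|p q cp cq|j js].
  - exact: coprimep1.
  - by rewrite coprimepMr cp.
  rewrite coprimep_expr // coprimep_XsubC2 // subr_eq0 (inj_eq inj_b).
  by apply: contraNneq i_s => <-.
have := dvdp_leq Q0 (dvd_prod _ (index_enum_uniq _)).
have -> : size (\prod_i ('X - (b i)%:P) ^+ (alpha i).+1) =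
          (\sum_(i < m) (alpha i).+1).+1.
  transitivity (size (polyB (fun i => (alpha i).+1) b (fun _ : 'I_0 => 0))).
    by rewrite /polyB big_ord0 mulr1.
  by rewrite size_polyB addn0.
under eq_bigr do rewrite -addn1.
rewrite big_split /= sum1_card card_ord => szQ.
have := leq_trans szQ (leq_size_deriv Q char0).
by rewrite dQ size_polyB !ltnS -addnS leq_add2l.
Qed.

(** * Generic points and separated values *)

Lemma exists_notin (K : closedFieldType) (s : seq K) : exists x, x \notin s.
Proof.
have /closed_nonrootP[x nrx] : \prod_(z <- s) ('X - z%:P) != 0.
  by rewrite monic_neq0 // monic_prod_XsubC.
by exists x; rewrite -root_prod_XsubC.
Qed.

Lemma exists_uniq (K : closedFieldType) (n : nat) :
  exists2 s : seq K, size s = n & uniq s.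
Proof.
elim: n => [|n [s szs us]]; first by exists [::].
have [x xs] := exists_notin s.
by exists (x :: s); rewrite /= ?szs ?xs.
Qed.

(** The factors are added one at a time. If V' = S' X, then V - c S is an antiderivative of S' (X -
    c), and its difference of values at [x] and [y] is affine in c with nonzero slope, so a single c
    is excluded besides [s] and [t]. *)
Lemma exists_separating (K : closedFieldType) (P R : {poly K}) (x y : K)
    (k : nat) (t : seq K) :
  [pchar K] =i pred0 -> R^`() = P -> R.[x] != R.[y] ->
  exists s : seq K, [/\ size s = k, uniq s, {in s, forall z, z \notin t} &
    exists2 S : {poly K},
      S^`() = P * \prod_(z <- s) ('X - z%:P) & S.[x] != S.[y]].
Proof.
move=> char0 dR Rxy; elim: k => [|k [s [szs us st [S dS Sxy]]]].
  by exists [::]; split=> //; exists R; rewrite // big_nil mulr1.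
have [V dV] := antiderivative_exists (S^`() * 'X) char0.
have [c] := exists_notin ((V.[x] - V.[y]) / (S.[x] - S.[y]) :: s ++ t).
rewrite inE mem_cat !negb_or => /and3P[cbad cs ct].
exists (c :: s); split=> /=; [by rewrite szs | by rewrite cs | | ].
  by move=> z; rewrite inE => /predU1P[->|/st].
exists (V - c *: S).
  by rewrite derivB derivZ dV big_cons mulrCA -dS mulrBl mul_polyC mulrC.
rewrite -subr_eq0.
have -> : (V - c *: S).[x] - (V - c *: S).[y] =
    V.[x] - V.[y] - c * (S.[x] - S.[y]) by rewrite !hornerE; ring.
apply: contraNneq cbad => /eqP; rewrite subr_eq0 => /eqP ->.
by rewrite mulfK // subr_eq0.
Qed.

(** * The numerator of a logarithmic derivative *)

(** The sum of (e+1)/(X - z) over the pairs (z, e), multiplied by the product of all X - z. Storing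
    e for the exponent e+1 matches the exponents that remain after differentiation. *)
Fixpoint logderiv_num (K : fieldType) (s : seq (K * nat)) : {poly K} :=
  if s is p :: s' then
    p.2.+1%:R *: \prod_(q <- s') ('X - q.1%:P) + ('X - p.1%:P) * logderiv_num s'
  else 0.

Lemma deriv_prod_XsubC_exp (K : fieldType) (s : seq (K * nat)) :
  (\prod_(p <- s) ('X - p.1%:P) ^+ p.2.+1)^`() =
  \prod_(p <- s) ('X - p.1%:P) ^+ p.2 * logderiv_num s.
Proof.
elim: s => [|p s IHs]; first by rewrite !big_nil derivC mulr0.
rewrite !big_cons derivM IHs deriv_exp derivXsubC mul1r /=.
have -> : \prod_(q <- s) ('X - q.1%:P) ^+ q.2.+1 =
    \prod_(q <- s) ('X - q.1%:P) * \prod_(q <- s) ('X - q.1%:P) ^+ q.2.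
  by rewrite -big_split; apply: eq_bigr => q _; rewrite exprS.
by rewrite exprS -scaler_nat -!mul_polyC; ring.
Qed.

(** The top coefficient is the sum of the exponents [p.2.+1], nonzero in characteristic 0. *)
Lemma size_logderiv_num (K : fieldType) (s : seq (K * nat)) :
  [pchar K] =i pred0 -> size (logderiv_num s) = size s.
Proof.
move=> /pcharf0P charE.
have [szT coefT] : (size (logderiv_num s) <= size s)%N /\
    (logderiv_num s)`_(size s).-1 = (\sum_(p <- s) p.2.+1)%:R.
  elim: s => [|p s [szT coefT]] /=.
    by rewrite size_poly0 coef0 big_nil.
  have szW : size (\prod_(q <- s) ('X - q.1%:P)) = (size s).+1.
    by rewrite size_prod_XsubC.
  split.
    rewrite (leq_trans (size_polyD _ _)) // geq_max.
    rewrite (leq_trans (size_scale_leq _ _)) ?szW //=.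
    by rewrite (leq_trans (size_polyMleq _ _)) // size_XsubC add2n.
  rewrite coefD coefZ big_cons natrD; congr (_ + _).
    rewrite -[X in _`_X]/((size s).+1.-1) -szW -lead_coefE lead_coef_prod_XsubC.
    by rewrite mulr1.
  rewrite mulrBl coefB coefXM coefCM [_`_(size s)]nth_default // mulr0 subr0.
  by case: (s) coefT => [_|q s' <-] //=; rewrite big_nil.
case: s szT coefT => [|p s] szT coefT; first by rewrite size_poly0.
apply/eqP; rewrite eqn_leq szT ltnNge; apply/negP => /leq_sizeP/(_ _ (leqnn _)).
by rewrite coefT big_cons addSn => /eqP; rewrite charE.
Qed.

(** At a node only the summand belonging to that node survives. This later separates the [a j] from
    the [b i]. *)
Lemma logderiv_num_neq0 (K : fieldType) (s : seq (K * nat)) (x : K) :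
  [pchar K] =i pred0 -> uniq (unzip1 s) -> x \in unzip1 s ->
  (logderiv_num s).[x] != 0.
Proof.
move=> /pcharf0P charE; elim: s => //= p s IHs /andP[ps us].
have rootW y : (\prod_(q <- s) ('X - q.1%:P)).[y] == 0 = (y \in unzip1 s).
  by rewrite -rootE -(big_map fst xpredT (fun z => 'X - z%:P)) root_prod_XsubC.
rewrite !hornerE inE => /predU1P[->|xs].
  by rewrite subrr mul0r addr0 mulf_neq0 ?charE ?rootW.
move: (rootW x); rewrite xs => /eqP ->; rewrite mulr0 add0r.
rewrite mulf_neq0 ?IHs // subr_eq0.
by apply: contraNneq ps => <-.
Qed.

(* A multiple root [x] of [(X - c) T + e W] satisfies
   [T^2 + e (W' T - W T') = 0] at [x], whatever [c] is, and then [c] is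
   determined by [x]; so only finitely many [c] have to be avoided. *)
Lemma exists_separable_logderiv_num (K : closedFieldType) (es : seq nat) :
  [pchar K] =i pred0 -> (1 < size es)%N ->
  exists cs : seq K, [/\ size cs = size es, uniq cs &
    separable_poly (logderiv_num (zip cs es))].
Proof.
move=> char0; have /pcharf0P charE := char0.
case: es => [|e es] //=; rewrite ltnS => es_gt0.
have [cs szcs ucs] := exists_uniq K (size es).
pose s := zip cs es; pose T := logderiv_num s.
pose W := \prod_(q <- s) ('X - q.1%:P).
have s1 : unzip1 s = cs by rewrite unzip1_zip // szcs.
have rootW y : (W.[y] == 0) = (y \in cs).
  have -> : W = \prod_(z <- cs) ('X - z%:P) by rewrite -s1 big_map.
  by rewrite -rootE root_prod_XsubC.
have T0 y : y \in cs -> T.[y] != 0.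
  by move=> ycs; rewrite logderiv_num_neq0 // s1.
pose D := T ^+ 2 + e.+1%:R *: (W^`() * T - W * T^`()).
have D0 : D != 0.
  suff [y Dy] : exists y, D.[y] != 0.
    by apply: contraNneq Dy => ->; rewrite horner0.
  (* At a node p of [s], W = 0, W' = w and T = (p.2+1) w, so D = w^2 (p.2+1) (p.2+1 + e+1). *)
  have: (0 < size s)%N by rewrite size_zip szcs minnn.
  rewrite /D /W /T; case: (s) s1 => [//|p s'] s1 _; exists p.1; move: ucs.
  rewrite -s1 /= => /andP[ps _].
  have : (\prod_(q <- s') ('X - q.1%:P)).[p.1] != 0.
    rewrite -rootE -(big_map fst xpredT (fun z => 'X - z%:P)).
    by rewrite root_prod_XsubC.
  rewrite big_cons derivM derivXsubC mul1r !hornerE subrr !mul0r !addr0 => w0.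
  set w := (\prod_(q <- s') _).[_] in w0 *.
  rewrite subr0 expr2 [X in X != 0](_ : _ = w ^+ 2 * (p.2.+1 * (p.2.+1 + e.+1))%:R).
    by rewrite mulf_neq0 ?expf_neq0 // charE.
  by rewrite natrM natrD; ring.
have [rs defD] := closed_field_poly_normal D.
have [c] := exists_notin (cs ++ [seq x + e.+1%:R * W.[x] / T.[x] | x <- rs]).
rewrite mem_cat negb_or => /andP[ccs cbad].
exists (c :: cs); split=> /=; [by rewrite szcs | by rewrite ccs | ].
rewrite separable_poly.unlock; apply: Pdiv.ClosedField.root_coprimep => x.
rewrite -/s -/W -/T rootE derivD derivZ derivM derivXsubC mul1r !hornerE.
move=> /eqP T1x; apply: contraNneq cbad => dT1x.
(* A zero of [T] here would be a zero of [W], hence a node, where [T] does not vanish. *)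
have Tx : T.[x] != 0.
  apply/negP => /eqP Tx; move: T1x; rewrite Tx mulr0 addr0 => /eqP.
  rewrite mulf_eq0 charE /= rootW => /T0; by rewrite Tx eqxx.
have {}dT1x : e.+1%:R * W^`().[x] + T.[x] + (x - c) * T^`().[x] = 0 := dT1x.
apply/mapP; exists x; last first.
  apply: (mulIf Tx); rewrite mulrDl divfK //.
  by apply/eqP; rewrite -subr_eq0 -oppr_eq0 -T1x; apply/eqP; ring.
rewrite -root_prod_XsubC -(rootZ _ _ (_ : lead_coef D != 0)) ?lead_coef_eq0 //.
rewrite -defD rootE /D !hornerE.
(* This combination eliminates [x - c] from the two equations at a multiple root. *)
rewrite [X in X == 0](_ : _ =
  T.[x] * (e.+1%:R * W^`().[x] + T.[x] + (x - c) * T^`().[x])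
  - T^`().[x] * (e.+1%:R * W.[x] + (x - c) * T.[x])); last by ring.
by rewrite dT1x T1x !mulr0 subrr.
Qed.

(** * Eigenvalues without and with an integrator *)

Lemma no_integrator_exists (K : closedFieldType) (m k : nat)
    (alpha : 'I_m -> nat) :
  [pchar K] =i pred0 -> (forall i, (2 <= alpha i)%N) -> (1 < m)%N ->
  exists (b : 'I_m -> K) (a : 'I_k -> K), pairwise_distinct b a /\
    ~ has_integrator (diagB alpha b a).
Proof.
move=> char0 alpha_ge2 m_gt1.
have [bs szb ub] := exists_uniq K m.
pose b (i : 'I_m) := bs`_i.
have inj_b : injective b.
  by move=> i j /eqP; rewrite nth_uniq ?szb ?ltn_ord // => /eqP/val_inj.
pose a0 (_ : 'I_0) : K := 0; pose i0 := Ordinal (ltnW m_gt1).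
have [R dR] := antiderivative_exists (polyB alpha b a0) char0.
(* Were [R] constant on the [b i], subtracting that constant would contradict the degree bound for
   [k = 0], which is [m <= 1]. *)
have /existsP[i1 Ri1] : [exists i, R.[b i] != R.[b i0]].
  apply/negbNE/negP => /existsPn eqR; have := m_gt1; rewrite ltnNge => /negP.
  apply.
  apply: (@root_antiderivative_le _ _ _ alpha b a0 (R - (R.[b i0])%:P)) => //.
    by rewrite derivB derivC subr0.
  by move=> i; rewrite rootE !hornerE subr_eq0; have := eqR i; rewrite negbK.
have [s [szs us sb [S dS Si1]]] :=
  exists_separating k [seq b i | i : 'I_m] char0 dR Ri1.
pose a (j : 'I_k) := s`_j.
have dist : pairwise_distinct b a.
  split=> [//|i j /eqP|i j].
    by rewrite nth_uniq ?szs ?ltn_ord // => /eqP/val_inj.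
  have /sb : a j \in s by rewrite mem_nth ?szs.
  by apply: contraNneq => <-; rewrite image_f.
exists b, a; split=> //; rewrite has_integrator_diagB // => -[Q [dQ rootQ]].
have defP : polyB alpha b a = S^`().
  by rewrite dS /polyB big_ord0 mulr1 (big_nth 0) szs big_mkord.
move: Si1; rewrite -subr_eq0 => /negP; apply.
(* [Q] and [S] differ by a constant, so the zeros of [Q] would force equal values of [S]. *)
have := antiderivative_sub_const (b i1) (b i0) char0 (etrans (esym defP) (esym dQ)).
rewrite !(rootP (rootQ _)) !subr0 => ->.
by rewrite subrr.
Qed.

Lemma integrator_exists (K : closedFieldType) (m k : nat)
    (alpha : 'I_m -> nat) :
  [pchar K] =i pred0 -> (forall i, (2 <= alpha i)%N) -> (1 < m <= k.+1)%N ->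
  exists (b : 'I_m -> K) (a : 'I_k -> K), pairwise_distinct b a /\
    has_integrator (diagB alpha b a).
Proof.
move=> char0 alpha_ge2 /andP[m_gt1 le_mk].
(* The zeros stand for the auxiliary points, which are simple roots of the antiderivative. With
   [k.+1] nodes the numerator [T] has degree [k], and its roots will be the [a j]. *)
pose es := [seq alpha i | i <- enum 'I_m] ++ nseq (k.+1 - m) 0%N.
have szes : size es = k.+1.
  by rewrite size_cat size_map size_enum_ord size_nseq subnKC.
have [|cs [szcs ucs sepT]] := @exists_separable_logderiv_num K es char0.
  by rewrite szes (leq_trans m_gt1).
rewrite szes in szcs.
set T := logderiv_num _ in sepT.
have szT : size T = k.+1.
  by rewrite size_logderiv_num // size_zip szcs szes minnn.
have T0 : lead_coef T != 0 by rewrite lead_coef_eq0 -size_poly_gt0 szT.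
have [rs defT] := closed_field_poly_normal T.
set c := lead_coef T in T0 defT.
have urs : uniq rs.
  rewrite -separable_prod_XsubC -(eqp_separable (eqp_scale _ T0)) -defT //.
have szrs : size rs = k.
  by apply/eqP; rewrite -eqSS -szT defT size_scale // size_prod_XsubC.
pose b (i : 'I_m) := cs`_i; pose a (j : 'I_k) := rs`_j.
have bcs i : b i \in cs by rewrite mem_nth ?szcs ?(leq_trans (ltn_ord i)).
have dist : pairwise_distinct b a.
  split=> [i j /eqP|i j /eqP|i j].
  - by rewrite nth_uniq ?szcs ?(leq_trans (ltn_ord _)) // => /eqP/val_inj.
  - by rewrite nth_uniq ?szrs // => /eqP/val_inj.
  have: T.[b i] != 0.
    by rewrite logderiv_num_neq0 // unzip1_zip ?szcs ?szes.
  apply: contraNneq => ->; rewrite -rootE defT rootZ // root_prod_XsubC.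
  by rewrite mem_nth ?szrs.
exists b, a; split=> //; apply/has_integrator_diagB => //.
(* The scalar compensates for the leading coefficient of [T]. *)
exists (c^-1 *: \prod_(p <- zip cs es) ('X - p.1%:P) ^+ p.2.+1).
split; last first.
  move=> i; rewrite rootZ ?invr_eq0 // -dvdp_XsubCl.
  have: b i \in unzip1 (zip cs es) by rewrite unzip1_zip ?szcs ?szes.
  case/mapP=> p pin ->; rewrite (big_rem p) //= exprS -mulrA.
  exact: dvdp_mulr.
rewrite derivZ deriv_prod_XsubC_exp -/T [in LHS]defT -scalerAr scalerA.
rewrite mulVf // scale1r /polyB; congr (_ * _); last first.
  by rewrite (big_nth 0) szrs big_mkord.
(* The auxiliary points carry exponent 0 and contribute 1 to the product. *)
have -> : zip cs es = [seq (b i, alpha i) | i <- enum 'I_m] ++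
    zip (drop m cs) (nseq (k.+1 - m) 0%N).
  rewrite -(cat_take_drop m cs) zip_cat; last first.
    by rewrite size_takel ?szcs // size_map size_enum_ord.
  rewrite cat_take_drop -zip_map; congr (zip _ _ ++ _).
  apply: (@eq_from_nth _ 0) => [|i].
    by rewrite size_takel ?szcs // size_map size_enum_ord.
  rewrite size_takel ?szcs // => im; rewrite nth_take //.
  by rewrite (nth_map (Ordinal im)) ?size_enum_ord // /b nth_enum_ord.
rewrite big_cat big_map big_enum /= [X in _ * X]big1_seq ?mulr1 // => p /=.
case/(map_f snd); rewrite -/(unzip2 _) unzip2_zip ?size_nseq ?size_drop ?szcs //.
by move=> /nseqP[-> _]; rewrite expr0.
Qed.

(** * The three cases *)

Theorem theorem3p13 (K : closedFieldType) (charK0 : [pchar K] =i pred0)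
    (m k : nat) (alpha : 'I_m -> nat) (alpha_ge2 : forall i, (2 <= alpha i)%N) :
  [/\ (m <= 1)%N ->
        forall (b : 'I_m -> K) (a : 'I_k -> K), pairwise_distinct b a ->
          has_integrator (diagB alpha b a),
      (k + 1 < m)%N ->
        forall (b : 'I_m -> K) (a : 'I_k -> K), pairwise_distinct b a ->
          ~ has_integrator (diagB alpha b a)
    & ~ (m <= 1)%N -> ~ (k + 1 < m)%N ->
        (exists (b : 'I_m -> K) (a : 'I_k -> K), pairwise_distinct b a /\
           has_integrator (diagB alpha b a)) /\
        (exists (b : 'I_m -> K) (a : 'I_k -> K), pairwise_distinct b a /\
           ~ has_integrator (diagB alpha b a))].
Proof.
split=> [m_le1 b a dist|lt_km b a dist|/negP m_gt1 /negP le_mk].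
- apply/has_integrator_diagB => //.
  have [Q dQ] := antiderivative_exists (polyB alpha b a) charK0.
  (* For [m = 0] there is no root condition; for [m = 1] the constant of integration is adjusted. *)
  case: m m_le1 alpha alpha_ge2 b dist dQ => [|[|//]] _ alpha _ b _ dQ.
    by exists Q; split=> // -[].
  exists (Q - (Q.[b ord0])%:P); split; first by rewrite derivB derivC subr0.
  by move=> i; rewrite (ord1 i) rootE !hornerE subrr.
- have [inj_b _ _] := dist; rewrite has_integrator_diagB // => -[Q [dQ rootQ]].
  have := root_antiderivative_le charK0 inj_b dQ rootQ.
  by rewrite leqNgt -addn1 lt_km.
rewrite -ltnNge in m_gt1; rewrite -leqNgt addn1 in le_mk.
split; first by apply: integrator_exists; rewrite ?m_gt1.
exact: no_integrator_exists.
Qed.
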